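(* Let $K$ be a field, $S=K[x_1,\ldots,x_n]$, and let $I\subset S$ be a monomial ideal. Then $t_a(I)\leq t_{a-1}(I)+t_1(I)$ for all $a\geq 1$.
   Context: $S=K[x_1,\ldots,x_n]$ is the polynomial ring over a field $K$ with the standard grading ($\deg x_i=1$). For the graded minimal free $S$-resolution $\mathbb{F}$ of $S/I$ write $\mathbb{F}_a=\bigoplus_j S(-j)^{b_{aj}}$ and set $t_a(I)=\max\{j : b_{aj}\neq 0\}$, the maximal degree of a homogeneous basis element of $\mathbb{F}_a$. If $\mathbb{F}_a=0$, the convention is $t_a(I)=\max\emptyset=-\infty$. Indexing: $\mathbb{F}$ resolves $S/I$, so $\mathbb{F}_0=S$ (for $I$ proper) and $t_1(I)$ is the maximal degree of a minimal generator of $I$. *)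

(* Defs.v *)
(* mpoly is imported before constructive_ereal: in the other order their notation
   levels clash. *)
From mathcomp Require Import all_boot all_order all_algebra.
From mathcomp Require Import mpoly.
From mathcomp Require Import constructive_ereal.

Set Implicit Arguments.
Unset Strict Implicit.
Unset Printing Implicit Defensive.

Import Order.TTheory GRing.Theory Num.Theory.
Local Open Scope ring_scope.

Definition ideal_gen (R : comNzRingType) (A : R -> Prop) (f : R) : Prop :=
  exists2 s : seq (R * R),
    forall c, c \in s -> A c.2 & f = \sum_(c <- s) c.1 * c.2.

Definition monomial_ideal (K : fieldType) (n : nat)
    (I : {pred {mpoly K[n]}}) : Prop :=
  exists A : 'X_{1..n} -> Prop,
    forall f, f \in I <-> ideal_gen (fun g => exists2 m, A m & g = 'X_[m]) f.

Definition irrelevant_ideal (K : fieldType) (n : nat) (f : {mpoly K[n]}) : Prop :=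
  ideal_gen (fun g => exists i : 'I_n, g = 'X_i) f.

(* Unlike [d.-homog], the degree is an integer: when [d < 0] the only
   homogeneous polynomial of degree [d] is 0. *)
Definition homogz (K : fieldType) (n : nat) (d : int) (f : {mpoly K[n]}) : bool :=
  all (fun m : 'X_{1..n} => (mdeg m)%:Z == d) (msupp f).

(* A graded free resolution
     ... -> F_2 -> F_1 -> F_0 -> S/I -> 0,   S = K[x_1, ..., x_n],
   by free modules of finite rank.  F_a = S^(rank a), with elements written as
   row vectors, has a homogeneous basis whose i-th element has degree [deg a i],
   i.e. F_a is the direct sum of the S(- deg a i).  The matrix [diff a] acts on
   the right and represents F_(a+1) -> F_a; [aug] lists representatives in S of
   the images in S/I of the basis of F_0.  Since S/I itself is not formed, equality in
   it is membership of the difference in I.  I may be the unit ideal, in which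
   case the minimal resolution has F_a = 0 for all a. *)
Record graded_free_resolution (K : fieldType) (n : nat)
    (I : {pred {mpoly K[n]}}) := GradedFreeResolution {
  rank : nat -> nat;
  deg : forall a, 'I_(rank a) -> int;
  diff : forall a, 'M[{mpoly K[n]}]_(rank a.+1, rank a);
  aug : 'cV[{mpoly K[n]}]_(rank 0);
  diff_homog : forall a i j, homogz (@deg a.+1 i - @deg a j) (diff a i j);
  aug_homog : forall i, homogz (@deg 0 i) (aug i 0);
  aug_surj : forall f : {mpoly K[n]},
    exists v : 'rV_(rank 0), f - (v *m aug) 0 0 \in I;
  exact_0 : forall v : 'rV_(rank 0),
    (v *m aug) 0 0 \in I <-> exists w : 'rV_(rank 1), v = w *m diff 0;
  exact_S : forall a (v : 'rV_(rank a.+1)),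
    v *m diff a = 0 <-> exists w : 'rV_(rank a.+2), v = w *m diff a.+1
}.

Arguments deg {K n I} F a i : rename.
Arguments diff {K n I} F a : rename.

(* The image of F_(a+1) lies in (x_1, ..., x_n) F_a for every a. *)
Definition minimal_resolution (K : fieldType) (n : nat)
    (I : {pred {mpoly K[n]}}) (F : graded_free_resolution I) : Prop :=
  forall a i j, irrelevant_ideal (diff F a i j).

(* The maximum of the empty family is -oo; +oo is never a value. *)
Definition max_degree (K : fieldType) (n : nat) (I : {pred {mpoly K[n]}})
    (F : graded_free_resolution I) (a : nat) : \bar int :=
  \big[Order.max/-oo%E]_(i < rank F a) (deg F a i)%:E.

(* Main.v *)
Require Import Defs.
From mathcomp Require Import all_boot all_order all_algebra.
From mathcomp Require Import perm.
From mathcomp Require Import mpoly.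
From mathcomp Require Import constructive_ereal.
From Stdlib Require Import ClassicalEpsilon.

Set Implicit Arguments.
Unset Strict Implicit.
Unset Printing Implicit Defensive.

Import Order.TTheory GRing.Theory Num.Theory.
Local Open Scope ring_scope.

(** The idea is that a generator [g] of [I] annihilates [S/I], so multiplication
    by [g] on the resolution [F] is homotopic to zero: [g = d H + H d].  Take a
    basis element [e_j] of [F_a] and read this identity in the coordinate
    [(j, j)].  If the summand of [e_j] through [F_(a+1)] contributes nothing,
    then some basis element [e_i] of [F_(a-1)] satisfies [d_(j,i) H_(i,j) <> 0],
    and since the entry [H_(i,j)] has degree [deg e_i + deg g - deg e_j], this
    degree is nonnegative, which is the claim.

    To kill the summand through [F_(a+1)] one uses the grading by [Z^n].  Let
    [al] be the multidegree of [e_j].  The basis elements of multidegree at most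
    [al] span a subcomplex, exact in its own right ([kernel_lift]), in which
    a homotopy for [g] exists as soon as [g] divides [x^al]
    ([truncated_homotopy]).  What remains of [g e_j] is a cycle of the
    subcomplex, and after division by a power product it has multidegree [al], so
    its [j]-th coordinate is a constant; by minimality that constant is zero
    ([multidegree_subadditive]).  A generator [g] dividing [x^al] is obtained by
    following nonzero entries of the differentials from [e_j] down to [F_1]
    ([generator_below]).

    The given resolution is graded by [Z] only, so its bases have to be changed
    to [Z^n]-homogeneous ones of the same degrees.  This is done one module at
    a time ([multigraded_base_change]).  If the row space of [E] is stable under
    taking [Z^n]-components, each component of each row of [E] is a combination of
    the rows of [E]; by minimality the constant parts of the coefficient
    vectors add up, for each row, to the corresponding unit vector.  Expanding
    the determinant of the identity matrix along these sums selects one component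
    per row such that the selected coefficient vectors form an invertible
    matrix.  The procedure starts because a monomial ideal is stable under
    taking [Z^n]-components. *)

(** * Polynomials and matrices homogeneous for a weight *)

Section Weights.

Variables (K : fieldType) (n : nat) (G : zmodType) (w : 'X_{1..n} -> G).
Hypothesis wD : {morph w : m1 m2 / (m1 + m2)%MM >-> m1 + m2}.

Implicit Types (d e : G) (f g : {mpoly K[n]}).

(** The weight [w] takes values in an arbitrary abelian group so that one theory
    serves the total degree and the multidegree. *)
Definition homw d f : bool := all (fun m => w m == d) (msupp f).

Definition compw d f : {mpoly K[n]} :=
  \sum_(m <- msupp f | w m == d) f@_m *: 'X_[m].

Lemma mcoeff_compw d f m : (compw d f)@_m = f@_m *+ (w m == d).
Proof.
rewrite /compw raddf_sum /= {3}[f]mpolyE raddf_sum /= -sumrMnl big_mkcond.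
apply: eq_bigr => m' _; rewrite !mcoeffZ !mcoeffX.
by case: (eqVneq m' m) => [->|_]; case: ifP; rewrite ?mulr0 ?mulr0n ?mul0rn.
Qed.

Lemma homwP d f : reflect (forall m, f@_m != 0 -> w m = d) (homw d f).
Proof.
apply: (iffP allP) => h m.
  by rewrite -mcoeff_msupp => /h/eqP.
by rewrite mcoeff_msupp => /h/eqP.
Qed.

Lemma homw_compwP d f : reflect (compw d f = f) (homw d f).
Proof.
apply: (iffP (homwP d f)) => [h|<- m].
  apply/mpolyP => m; rewrite mcoeff_compw; have [->|/h ->] := eqVneq f@_m 0.
    by rewrite mul0rn.
  by rewrite eqxx.
by rewrite mcoeff_compw; case: (w m =P d) => // _; rewrite eqxx.
Qed.

Lemma compw0 d : compw d 0 = 0.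
Proof. by apply/mpolyP => m; rewrite mcoeff_compw mcoeff0 mul0rn. Qed.

Lemma homw_comp d f : homw d (compw d f).
Proof. by apply/homwP => m; rewrite mcoeff_compw; case: (w m =P d) => // _; rewrite eqxx. Qed.

Lemma homw0 d : homw d 0.
Proof. by apply/homw_compwP/compw0. Qed.

Lemma compw_sum d (J : Type) (s : seq J) (P : pred J) (F : J -> {mpoly K[n]}) :
  compw d (\sum_(j <- s | P j) F j) = \sum_(j <- s | P j) compw d (F j).
Proof.
apply/mpolyP => m; rewrite mcoeff_compw !raddf_sum /= -sumrMnl.
by apply: eq_bigr => j _ /=; rewrite mcoeff_compw.
Qed.

(** Only the factor [f] has to be homogeneous: this is what makes taking
    components commute with multiplication by a homogeneous matrix. *)
Lemma compwMl d e f g : homw e f -> compw d (f * g) = f * compw (d - e) g.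
Proof.
move=> /homwP hf; apply/mpolyP => m; rewrite mcoeff_compw.
rewrite !mcoeffM -sumrMnl; apply: eq_bigr => k /eqP hm; rewrite mcoeff_compw.
have -> : w m = w k.1 + w k.2 by rewrite -wD; congr w.
rewrite -mulrnAr; have [->|/hf <-] := eqVneq f@_k.1 0; first by rewrite !mul0r.
by rewrite [in RHS]eq_sym subr_eq [w k.2 + _]addrC [in RHS]eq_sym.
Qed.

Lemma homw_sum d (J : Type) (s : seq J) (P : pred J) (F : J -> {mpoly K[n]}) :
  (forall j, P j -> homw d (F j)) -> homw d (\sum_(j <- s | P j) F j).
Proof.
move=> hF; apply/homw_compwP; rewrite compw_sum.
by apply: eq_bigr => j /hF /homw_compwP.
Qed.

Lemma homwZ d c f : homw d f -> homw d (c *: f).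
Proof.
move=> /homwP hf; apply/homwP => m; rewrite mcoeffZ => h; apply: hf.
by apply: contraNneq h => ->; rewrite mulr0.
Qed.

Lemma homwM d e f g : homw d f -> homw e g -> homw (d + e) (f * g).
Proof.
move=> hf /homw_compwP hg; apply/homw_compwP.
by rewrite (compwMl _ _ hf) addrAC subrr add0r hg.
Qed.

Lemma homw1 : homw 0 1.
Proof.
apply/homwP => m; rewrite mcoeff1; case: (eqVneq m 0%MM) => [-> _|]; last first.
  by rewrite eqxx.
by apply: (addIr (w 0%MM)); rewrite -wD addm0 add0r.
Qed.

Lemma homw_prod (J : finType) (e : J -> G) (F : J -> {mpoly K[n]}) :
  (forall j, homw (e j) (F j)) -> homw (\sum_j e j) (\prod_j F j).
Proof.
move=> hF; apply: (big_rec2 (fun f d => homw d f)); first exact: homw1.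
by move=> j f d _; apply: homwM.
Qed.

(** [A] represents a degree-preserving map, acting on row vectors, between free
    modules whose bases have degrees [dr] and [dc].  A homogeneous element of
    degree [d] is a row with constant [dr = d]. *)
Definition hommx p q (dr : 'I_p -> G) (dc : 'I_q -> G)
    (A : 'M[{mpoly K[n]}]_(p, q)) : Prop :=
  forall i j, homw (dr i - dc j) (A i j).

Definition compmx p q (dr : 'I_p -> G) (dc : 'I_q -> G)
    (A : 'M[{mpoly K[n]}]_(p, q)) : 'M_(p, q) :=
  \matrix_(i, j) compw (dr i - dc j) (A i j).

Lemma hommx_comp p q (dr : 'I_p -> G) (dc : 'I_q -> G) A :
  hommx dr dc (compmx dr dc A).
Proof. by move=> i j; rewrite mxE homw_comp. Qed.

Lemma hommx_compP p q (dr : 'I_p -> G) (dc : 'I_q -> G) A :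
  hommx dr dc A <-> compmx dr dc A = A.
Proof.
split=> [h|<-]; last exact: hommx_comp.
by apply/matrixP => i j; rewrite mxE; apply/homw_compwP.
Qed.

Lemma compmx0 p q (dr : 'I_p -> G) (dc : 'I_q -> G) : compmx dr dc 0 = 0.
Proof. by apply/matrixP => i j; rewrite !mxE compw0. Qed.

Lemma compmxM p q r (dr : 'I_p -> G) (dc : 'I_q -> G) (de : 'I_r -> G) A B :
  hommx dc de B -> compmx dr de (A *m B) = compmx dr dc A *m B.
Proof.
move=> hB; apply/matrixP => i j; rewrite !mxE compw_sum; apply: eq_bigr => k _.
by rewrite mxE mulrC (compwMl _ _ (hB k j)) mulrC opprB addrA subrK.
Qed.

Lemma hommxM p q r (dr : 'I_p -> G) (dc : 'I_q -> G) (de : 'I_r -> G) A B :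
  hommx dr dc A -> hommx dc de B -> hommx dr de (A *m B).
Proof.
by move=> /hommx_compP hA hB; apply/hommx_compP; rewrite (compmxM _ _ hB) hA.
Qed.

Lemma hommxB p q (dr : 'I_p -> G) (dc : 'I_q -> G) A B :
  hommx dr dc A -> hommx dr dc B -> hommx dr dc (A - B).
Proof.
move=> hA hB i j; rewrite !mxE; apply/homwP => m; rewrite mcoeffB.
have [->|/(homwP _ _ (hA i j)) -> //] := eqVneq (A i j)@_m 0.
have [->|/(homwP _ _ (hB i j)) -> //] := eqVneq (B i j)@_m 0.
by rewrite subrr eqxx.
Qed.

Lemma hommx_shift p q (dr : 'I_p -> G) (dc : 'I_q -> G) A e :
  hommx dr dc A -> hommx (fun i => dr i + e) (fun j => dc j + e) A.
Proof. by move=> hA i j; rewrite opprD addrACA subrr addr0. Qed.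

Lemma hommx_row p q (dr : 'I_p -> G) (dc : 'I_q -> G) A i :
  hommx dr dc A -> hommx (fun _ => dr i) dc (row i A).
Proof. by move=> hA j k; rewrite mxE. Qed.

Lemma hommx1 p (dr : 'I_p -> G) : hommx dr dr 1%:M.
Proof.
move=> i j; rewrite mxE; case: eqP => [->|_]; last exact: homw0.
by rewrite subrr homw1.
Qed.

(** The homogeneous component of [invmx A] of the right degrees is again a left
    inverse of [A], hence equals [invmx A]. *)
Lemma hommx_inv p (dr dc : 'I_p -> G) A :
  A \in unitmx -> hommx dr dc A -> hommx dc dr (invmx A).
Proof.
move=> uA hA; apply/hommx_compP.
have h1 := compmxM dc (invmx A) hA.
rewrite mulVmx // ((hommx_compP _ _ _).1 (@hommx1 _ dc)) in h1.
by rewrite -[LHS](mulmxK uA) -h1 mul1mx.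
Qed.

(** Every term of the Leibniz expansion has weight
    [\sum_i (dr i - dr (s i)) = 0]. *)
Lemma homw_det p (dr : 'I_p -> G) A : hommx dr dr A -> homw 0 (\det A).
Proof.
move=> hA; apply: homw_sum => s _.
have h : homw 0 (\prod_i A i (s i)).
  have -> : 0 = \sum_i (dr i - dr (s i)).
    rewrite sumrB [X in _ - X](_ : _ = \sum_i dr i) ?subrr //.
    by rewrite [RHS](reindex_inj (@perm_inj _ s)).
  by apply: homw_prod => i; apply: hA.
by case: (odd_perm s); rewrite ?expr0 ?mul1r // expr1 mulN1r /homw (perm_all _ (msuppN _)).
Qed.

Lemma sum_compw d (s : seq G) f :
  uniq s -> (forall m, m \in msupp f -> w m + d \in s) ->
  \sum_(e <- s) compw (e - d) f = f.
Proof.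
move=> us hs; apply/mpolyP => m; rewrite raddf_sum /=.
have [m0|] := boolP (m \in msupp f); last first.
  rewrite -mcoeff_eq0 => /eqP fm; rewrite fm big1 // => e _.
  by rewrite mcoeff_compw fm mul0rn.
rewrite (bigD1_seq (w m + d)) ?hs //= mcoeff_compw addrK eqxx big1 ?addr0 //.
move=> e ne; rewrite mcoeff_compw; case: eqP => // he.
by rewrite he subrK eqxx in ne.
Qed.

End Weights.

(** * Change to a multihomogeneous basis *)

Definition zdeg n (m : 'X_{1..n}) : int := (mdeg m)%:Z.

Lemma zdegD n : {morph @zdeg n : m1 m2 / (m1 + m2)%MM >-> m1 + m2}.
Proof. by move=> m1 m2; rewrite /zdeg mdegD PoszD. Qed.

(** Exponents are taken in [Z] rather than [nat] so that multidegrees form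
    a group. *)
Definition wexp n (m : 'X_{1..n}) : {ffun 'I_n -> int} := [ffun i => (m i)%:Z].

Lemma wexpD n : {morph @wexp n : m1 m2 / (m1 + m2)%MM >-> m1 + m2}.
Proof. by move=> m1 m2; apply/ffunP => i; rewrite !ffunE mnmDE PoszD. Qed.

Definition tot n (al : {ffun 'I_n -> int}) : int := \sum_i al i.

Lemma totB n (al be : {ffun 'I_n -> int}) : tot (al - be) = tot al - tot be.
Proof. by rewrite /tot -sumrB; apply: eq_bigr => i _; rewrite !ffunE. Qed.

Lemma tot_wexp n (m : 'X_{1..n}) : tot (wexp m) = zdeg m.
Proof.
rewrite /tot /zdeg mdegE -natz raddf_sum /=.
by apply: eq_bigr => i _; rewrite ffunE natz.
Qed.

Local Notation cst K n := (@mcoeff n K 0%MM).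

(** Multilinearity of the determinant in its rows. *)
Lemma det_sum_rows (R : comNzRingType) (p : nat) (J : finType)
    (c : 'I_p -> J -> 'rV[R]_p) :
  \det (\matrix_k \sum_x c k x) =
  \sum_(f : {ffun 'I_p -> J}) \det (\matrix_k c k (f k)).
Proof.
rewrite /determinant exchange_big; apply: eq_bigr => s _ /=.
rewrite -mulr_sumr; congr (_ * _).
under eq_bigr do rewrite mxE summxE.
rewrite bigA_distr_bigA; apply: eq_bigr => f _.
by apply: eq_bigr => i _; rewrite mxE.
Qed.

Section BaseChange.

Variables (K : fieldType) (n : nat).

Lemma homw0_const (f : {mpoly K[n]}) : homw (@zdeg n) 0 f -> f = (f@_0)%:MP.
Proof.
move=> /homwP hf; apply/mpolyP => m; rewrite mcoeffC.
have [-> | nm] := eqVneq m 0%MM; first by rewrite mulr1.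
rewrite mulr0; apply/eqP; apply: contraTT nm => /hf /eqP.
by rewrite negbK /zdeg eqz_nat mdeg_eq0.
Qed.

(** For a homogeneous square matrix with equal source and target degrees, the
    determinant has degree 0, hence is a constant; this plays the role of
    Nakayama's lemma. *)
Lemma unitmx_const p (de : 'I_p -> int) (A : 'M[{mpoly K[n]}]_p) :
  hommx (@zdeg n) de de A -> \det (map_mx (cst K n) A) != 0 -> A \in unitmx.
Proof.
move=> hA; rewrite det_map_mx unitmxE => nz.
have := homw0_const (homw_det (@zdegD n) hA); set c := (_)@__ in nz * => ->.
by apply: rmorph_unit; rewrite unitfE.
Qed.

Lemma homw_tot (d : int) (be : {ffun 'I_n -> int}) (f : {mpoly K[n]}) :
  homw (@zdeg n) d f -> tot be != d -> compw (@wexp n) be f = 0.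
Proof.
move=> /homwP hf nd; apply/mpolyP => m; rewrite mcoeff_compw mcoeff0.
have [->|/hf hm] := eqVneq f@_m 0; first by rewrite mul0rn.
by case: eqP => // hb; rewrite -hb tot_wexp hm eqxx in nd.
Qed.

Lemma homw_wexp_zdeg (d : int) (be : {ffun 'I_n -> int}) (f : {mpoly K[n]}) :
  homw (@zdeg n) d f -> homw (@zdeg n) d (compw (@wexp n) be f).
Proof.
move=> /homwP hf; apply/homwP => m; rewrite mcoeff_compw => h; apply: hf.
by apply: contraNneq h => ->; rewrite mul0rn.
Qed.

(** The hypothesis on the kernel says that the rows of [E] generate their span
    minimally.  Since total degrees are kept, the degrees of
    the given basis can be read off the new one. *)
Lemma multigraded_base_change p q (E : 'M[{mpoly K[n]}]_(p, q))
    (de' : 'I_p -> int) (de : 'I_q -> int) (mu : 'I_q -> {ffun 'I_n -> int}) :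
  (forall j, tot (mu j) = de j) ->
  hommx (@zdeg n) de' de E ->
  (forall v : 'rV_p, v *m E = 0 -> map_mx (cst K n) v = 0) ->
  (forall al (v : 'rV_p),
     exists u : 'rV_p, compmx (@wexp n) (fun _ => al) mu (v *m E) = u *m E) ->
  exists P : 'M_p, exists mu' : 'I_p -> {ffun 'I_n -> int},
    [/\ P \in unitmx, hommx (@zdeg n) de' de' P,
        forall k, tot (mu' k) = de' k & hommx (@wexp n) mu' mu (P *m E)].
Proof.
move=> tmu hE indep closed.
(* [s] lists all multidegrees that occur in some row of [E]. *)
pose s := undup (flatten [seq [seq wexp m + mu j | m <- msupp (E k j)]
                         | k <- enum 'I_p, j <- enum 'I_q]).
pose al (x : 'I_(size s)) := tnth (in_tuple s) x.
pose cE k x := compmx (@wexp n) (fun _ : 'I_1 => al x) mu (row k E).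
have sum_cE k : \sum_x cE k x = row k E.
  apply/rowP => j; rewrite summxE -[RHS](@sum_compw _ _ _ (@wexp n) (mu j) s).
  - by rewrite [RHS]big_tnth; apply: eq_bigr => x _; rewrite mxE.
  - exact: undup_uniq.
  - move=> m hm; rewrite mem_undup; apply/flattenP.
    exists [seq wexp m + mu j | m <- msupp (E k j)].
      by apply: allpairs_f; rewrite mem_enum.
    by apply: map_f; rewrite mxE in hm.
have hcE k x : hommx (@zdeg n) (fun _ => de' k) de (cE k x).
  by move=> i j; rewrite mxE; apply: homw_wexp_zdeg; rewrite mxE.
have : forall k x, exists c : 'rV_p,
    c *m E = cE k x /\ hommx (@zdeg n) (fun _ => de' k) de' c.
  move=> k x; have [u hu] := closed (al x) (delta_mx 0 k).
  rewrite -rowE in hu.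
  (* Row [k] has total degree [de' k], hence so do its multidegree
     components; the coefficients may be replaced by their parts of the
     matching degree. *)
  exists (compmx (@zdeg n) (fun _ => de' k) de' u); split; last exact: hommx_comp.
  by rewrite -(compmxM (@zdegD n) _ _ hE) -hu; apply/hommx_compP/hcE.
move=> /(fun h k => fin_all_exists (h k)) /fin_all_exists [c hc].
have sum_c k : \sum_x map_mx (cst K n) (c k x) = row k 1%:M.
  apply/eqP; rewrite -subr_eq0; apply/eqP.
  have := indep (\sum_x c k x - row k 1%:M).
  rewrite mulmxBl mulmx_suml -row_mul mul1mx -(sum_cE k).
  rewrite (eq_bigr (cE k)) ?subrr; last by move=> x _; case: (hc k x).
  move=> /(_ erefl); rewrite map_mxB raddf_sum /= => e0.
  rewrite [row k 1%:M](_ : _ = map_mx (cst K n) (row k 1%:M)) //.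
  by apply/rowP => i; rewrite !mxE rmorph_nat.
have : \det (\matrix_k \sum_x map_mx (cst K n) (c k x)) != 0.
  suff -> : \matrix_k \sum_x map_mx (cst K n) (c k x) = 1%:M.
    by rewrite det1 oner_neq0.
  by apply/row_matrixP => k; rewrite rowK sum_c.
rewrite det_sum_rows => /eqP nz.
have [f hf] : exists f : {ffun 'I_p -> 'I_(size s)},
    \det (\matrix_k map_mx (cst K n) (c k (f k))) != 0.
  apply/existsP; apply: contra_notT nz => /existsPn h.
  by apply: big1 => f _; apply/eqP; rewrite -[_ == _]negbK h.
exists (\matrix_k c k (f k)), (fun k => al (f k)).
have hP : hommx (@zdeg n) de' de' (\matrix_k c k (f k)).
  by move=> i j; rewrite mxE; apply: (hc i (f i)).2.
split=> [|//||].
- apply: (unitmx_const hP); move: hf; congr (\det _ != 0).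
  by apply/row_matrixP => i; rewrite -map_row !rowK.
- move=> k; apply/eqP; apply: contraNT hf => nk.
  (* If the degrees differ, the selected component of row [k] is 0, and
     minimality gives a zero row in an invertible matrix. *)
  have ck0 : map_mx (cst K n) (c k (f k)) = 0.
    apply: indep; rewrite (hc k (f k)).1; apply/rowP => j; rewrite !mxE.
    by apply: (homw_tot (hE k j)); rewrite totB tmu (inj_eq (addIr _)).
  rewrite (expand_det_row _ k) big1 // => j _.
  by rewrite mxE ck0 mxE mul0r.
- move=> k j.
  have -> : (\matrix_k c k (f k) *m E) k j = cE k (f k) 0 j.
    rewrite -(hc k (f k)).1 -[c k (f k)](rowK (fun i => c i (f i))).
    by rewrite -row_mul [RHS]mxE.
  exact: hommx_comp.
Qed.

End BaseChange.

(** * Subadditivity for complexes graded by [Z^n] *)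

Definition leZ n (al be : {ffun 'I_n -> int}) : bool := [forall i, al i <= be i].

Definition minZ n (al be : {ffun 'I_n -> int}) : {ffun 'I_n -> int} :=
  [ffun i => Num.min (al i) (be i)].

Lemma leZP n (al be : {ffun 'I_n -> int}) :
  reflect (forall i, al i <= be i) (leZ al be).
Proof. exact: forallP. Qed.

Lemma leZ_trans n (be al ga : {ffun 'I_n -> int}) :
  leZ al be -> leZ be ga -> leZ al ga.
Proof. by move=> /leZP h1 /leZP h2; apply/leZP => i; apply: le_trans (h2 i). Qed.

Lemma leZ_tot n (al be : {ffun 'I_n -> int}) : leZ al be -> tot al <= tot be.
Proof. by move=> /leZP h; apply: ler_sum => i _. Qed.

Lemma totD n (al be : {ffun 'I_n -> int}) : tot (al + be) = tot al + tot be.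
Proof. by rewrite /tot -big_split; apply: eq_bigr => i _; rewrite !ffunE. Qed.

Lemma wexp_inj n : injective (@wexp n).
Proof.
move=> m1 m2 /ffunP h; apply/mnmP => i.
by have := h i; rewrite !ffunE => -[].
Qed.

Section Multihomogeneous.

Variables (K : fieldType) (n : nat).
Implicit Types (al be ga : {ffun 'I_n -> int}) (f : {mpoly K[n]}).

Lemma homw_wexp_monomial al f : homw (@wexp n) al f -> f != 0 ->
  exists m, wexp m = al /\ f = f@_m *: 'X_[m].
Proof.
move=> /homwP hf nf; have [m hm] : exists m, m \in msupp f.
  case E: (msupp f) => [|m s]; last by exists m; rewrite mem_head.
  by rewrite -msupp_eq0 E in nf.
exists m; rewrite mcoeff_msupp in hm; split; first exact: hf.
apply/mpolyP => m'; rewrite mcoeffZ mcoeffX.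
have [<-|nm] := eqVneq m m'; first by rewrite mulr1.
rewrite mulr0; apply/eqP; apply: contraNT nm => hm'; apply/eqP.
by apply: wexp_inj; rewrite !hf.
Qed.

Lemma homw_leZ al be f : homw (@wexp n) (al - be) f -> f != 0 -> leZ be al.
Proof.
move=> /homw_wexp_monomial h /h [m [/ffunP hm _]]; apply/leZP => i.
by have := hm i; rewrite !ffunE -subr_ge0 => <-.
Qed.

(** If [be] exceeds [al] in some variables, an entry sitting over a basis element
    of multidegree at most [al] is divisible by the corresponding powers of these
    variables. *)
Lemma homw_divX al be ga m f :
  wexp m = be - minZ al be -> (f != 0 -> leZ ga al) ->
  homw (@wexp n) (be - ga) f ->
  exists2 f', f = 'X_[m] * f' & homw (@wexp n) (minZ al be - ga) f'.
Proof.
move=> /ffunP hm hga hf; have [->|nf] := eqVneq f 0.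
  by exists 0; rewrite ?mulr0 ?homw0.
have [m0 [/ffunP hm0 ->]] := homw_wexp_monomial hf nf.
have /leZP ga_al := hga nf; have /leZP ga_be := homw_leZ hf nf.
have lem : (m <= m0)%MM.
  apply/mnm_lepP => i; rewrite -lez_nat.
  have := hm i; have := hm0 i; rewrite !ffunE => -> ->.
  by rewrite lerD2l lerN2 le_min ga_al ga_be.
exists (f@_m0 *: 'X_[m0 - m]).
  by rewrite -scalerAr -mpolyXD addmC submK.
apply/homwP => m1; rewrite mcoeffZ mcoeffX.
have [<- _|_] := eqVneq (m0 - m)%MM m1; last by rewrite mulr0 eqxx.
apply/ffunP => i; rewrite !ffunE mnmBE -subzn; last by move/mnm_lepP: lem.
have := hm i; have := hm0 i; rewrite !ffunE => -> ->.
by rewrite opprB addrC addrA subrK.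
Qed.

Lemma hommx_divX p (mu : 'I_p -> {ffun 'I_n -> int}) al be (u : 'rV[{mpoly K[n]}]_p) :
  hommx (@wexp n) (fun _ => be) mu u -> (forall l, u 0 l != 0 -> leZ (mu l) al) ->
  exists m (u' : 'rV_p), [/\ wexp m = be - minZ al be,
    u = 'X_[m] *: u' & hommx (@wexp n) (fun _ => minZ al be) mu u'].
Proof.
move=> hu su; pose m := [multinom `|be i - Num.min (al i) (be i)|%N | i < n].
have hm : wexp m = be - minZ al be.
  apply/ffunP => i; rewrite !ffunE mnmE gez0_abs // subr_ge0.
  by rewrite ge_min lexx orbT.
have : forall l, exists f', u 0 l = 'X_[m] * f' /\ homw (@wexp n) (minZ al be - mu l) f'.
  by move=> l; have [f'] := homw_divX hm (su l) (hu 0 l); exists f'.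
move=> /fin_all_exists [f' hf']; exists m, (\row_l f' l); split=> //.
  by apply/rowP => l; rewrite !mxE; case: (hf' l).
by move=> i l; rewrite mxE; case: (hf' l).
Qed.

Lemma mpolyX_neq0 m : 'X_[m] != 0 :> {mpoly K[n]}.
Proof. by rewrite -msupp_eq0 msuppX. Qed.

Lemma scaler_mx_eq0 p q (c : {mpoly K[n]}) (A : 'M_(p, q)) :
  c != 0 -> c *: A = 0 -> A = 0.
Proof.
move=> nc /matrixP h; apply/matrixP => i j; have := h i j; rewrite !mxE => /eqP.
by rewrite mulf_eq0 (negPf nc) => /eqP.
Qed.

End Multihomogeneous.

(** The differentials [E b] are those of a minimal multigraded resolution of
    a cyclic module, from [F_(b+1)] to [F_b], acting on row vectors. *)
Section Subadditivity.

Variables (K : fieldType) (n : nat) (r : nat -> nat).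
Variable mu : forall b, 'I_(r b) -> {ffun 'I_n -> int}.
Variable E : forall b, 'M[{mpoly K[n]}]_(r b.+1, r b).
Hypothesis homE : forall b, hommx (@wexp n) (@mu b.+1) (@mu b) (E b).
Hypothesis exactE : forall b (v : 'rV_(r b.+1)),
  v *m E b = 0 <-> exists u : 'rV_(r b.+2), v = u *m E b.+1.
Hypothesis minE : forall b, map_mx (cst K n) (E b) = 0.
Hypothesis rank0 : forall i j : 'I_(r 0), i = j.
Hypothesis mu0 : forall i : 'I_(r 0), mu i = 0.

Lemma kernel_const0 b (v : 'rV_(r b.+1)) : v *m E b = 0 -> map_mx (cst K n) v = 0.
Proof. by case/exactE => u ->; rewrite map_mxM minE mulmx0. Qed.

Lemma complexE b : E b.+1 *m E b = 0.
Proof.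
apply/row_matrixP => i; rewrite row_mul row0; apply/exactE.
by exists (delta_mx 0 i); rewrite -rowE.
Qed.

(** A basis element in the kernel would be a boundary with a coordinate equal
    to 1, contradicting minimality. *)
Lemma row_neq0 b (k : 'I_(r b.+1)) : exists j, E b k j != 0.
Proof.
apply/existsP; apply: contraT => /existsPn h.
have e0 : (delta_mx 0 k : 'rV_(r b.+1)) *m E b = 0.
  by rewrite -rowE; apply/rowP => j; rewrite !mxE; apply/eqP; rewrite -[_ == _]negbK.
by have /rowP/(_ k) := kernel_const0 e0; rewrite !mxE !eqxx mcoeff1 eqxx => /eqP; rewrite oner_eq0.
Qed.

Lemma leZ_entry b k j : E b k j != 0 -> leZ (mu j) (mu k).
Proof. exact: homw_leZ (homE k j). Qed.

Lemma generator_below b (j : 'I_(r b.+1)) : exists k : 'I_(r 1), leZ (mu k) (mu j).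
Proof.
elim: b j => [|b IHb] j; first by exists j; apply/leZP.
have [i /leZ_entry hi] := row_neq0 j; have [k hk] := IHb i.
by exists k; apply: leZ_trans hi.
Qed.

(** Exactness of the subcomplex spanned by the basis elements of multidegree at
    most [al].  Dividing [u] by a power product brings its multidegree down to
    [minZ al be <= al], and a preimage of multidegree at most [al] can only
    involve basis elements of multidegree at most [al]. *)
Lemma kernel_lift b al be (u : 'rV_(r b.+1)) :
  hommx (@wexp n) (fun _ => be) (@mu b.+1) u ->
  (forall l, u 0 l != 0 -> leZ (mu l) al) -> u *m E b = 0 ->
  exists v : 'rV_(r b.+2), [/\ u = v *m E b.+1,
    hommx (@wexp n) (fun _ => be) (@mu b.+2) v &
    forall l, v 0 l != 0 -> leZ (mu l) al].
Proof.
move=> hu su uE; have [m [u' [hm def_u hu']]] := hommx_divX hu su.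
have /exactE [v' def_u'] : u' *m E b = 0.
  by apply: (scaler_mx_eq0 (mpolyX_neq0 K m)); rewrite scalemxAl -def_u.
pose v := compmx (@wexp n) (fun _ => minZ al be) (@mu b.+2) v'.
have hv : hommx (@wexp n) (fun _ => minZ al be) (@mu b.+2) v by apply: hommx_comp.
exists ('X_[m] *: v); split.
- rewrite -scalemxAl -(compmxM (@wexpD n) _ _ (@homE b.+1)) -def_u'.
  by rewrite ((hommx_compP _ _ _ _).1 hu').
- move=> i l; rewrite mxE.
  rewrite (_ : be - mu l = wexp m + (minZ al be - mu l)); last by rewrite hm addrA subrK.
  apply: (homwM (@wexpD n)); last exact: hv.
  by rewrite /homw msuppX /= eqxx.
- move=> l; rewrite mxE mulf_eq0 negb_or => /andP[_ nv].
  apply: leZ_trans (homw_leZ (hv 0 l) nv) _.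
  by apply/leZP => i; rewrite ffunE ge_min lexx.
Qed.

(** The part of [g e_i] that [H] does not account for is what the next step of
    the homotopy has to lift along the differential; this lemma gives the degree
    and the support that [kernel_lift] asks for. *)
Lemma homotopy_defect b al ga g (H : 'M[{mpoly K[n]}]_(r b, r b.+1)) i :
  homw (@wexp n) ga g ->
  hommx (@wexp n) (fun i => mu i + ga) (@mu b.+1) H ->
  (forall s l, H s l != 0 -> leZ (mu l) al) -> leZ (mu i) al ->
  hommx (@wexp n) (fun _ => mu i + ga) (@mu b.+1) (row i (g%:M - E b *m H)) /\
  forall l, row i (g%:M - E b *m H) 0 l != 0 -> leZ (mu l) al.
Proof.
move=> hg hH sH ial; split.
  have hgM : hommx (@wexp n) (fun i => mu i + ga) (@mu b.+1) g%:M.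
    move=> i1 l; rewrite mxE; case: eqP => [->|_]; last exact: homw0.
    by rewrite /= mulr1n addrAC subrr add0r.
  have hEH := hommxM (@wexpD n) (hommx_shift ga (@homE b)) hH.
  by apply: (hommx_row (dr := fun i => mu i + ga)); apply: hommxB.
move=> l; apply: contraNT => nl; rewrite !mxE.
have /negPf -> : i != l by apply: contraNneq nl => <-.
rewrite sub0r oppr_eq0; apply/eqP/big1 => s _.
suff -> : H s l = 0 by rewrite mulr0.
by apply/eqP; apply: contraNT nl => /sH.
Qed.

(** One component [H : F_b -> F_(b+1)] of a null homotopy of the multiplication
    by [g = E 0 k z] on the subcomplex of multidegrees at most [al].  Instead of
    the homotopy identity, which involves two components, the last clause records
    what makes it possible to construct the next one. *)
Lemma truncated_homotopy (al : {ffun 'I_n -> int}) (z : 'I_(r 0)) (k : 'I_(r 1)) b :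
  leZ (mu k) al ->
  exists H : 'M[{mpoly K[n]}]_(r b, r b.+1),
    [/\ hommx (@wexp n) (fun i => mu i + mu k) (@mu b.+1) H,
        forall i l, H i l != 0 -> leZ (mu l) al &
        forall i, leZ (mu i) al -> row i ((E 0 k z)%:M - E b *m H) *m E b = 0].
Proof.
move=> kal; set g := E 0 k z.
have hg : homw (@wexp n) (mu k) g by have := homE k z; rewrite mu0 subr0.
elim: b => [|b [H [hH sH eH]]].
  (* On [F_0 = S] the homotopy sends 1 to the basis element [e_k], whose image
     under the differential is [g]. *)
  exists (\matrix_(i, l) (l == k)%:R); split.
  - move=> i l; rewrite mxE mu0 add0r; case: eqP => [->|_]; last exact: homw0.
    by rewrite subrr (homw1 _ (@wexpD n)).
  - by move=> i l; rewrite mxE; case: (l =P k) => [-> //|_]; rewrite eqxx.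
  - move=> i _; rewrite -row_mul mulmxBl mul_scalar_mx; apply/rowP => j.
    rewrite !mxE (rank0 j z).
    rewrite (bigD1 k) //= big1 ?addr0 => [|l nl]; last first.
      rewrite mxE big1 ?mul0r // => s _; rewrite mxE (negPf nl) ?mulr0 //.
    rewrite mxE (bigD1 z) //= big1 ?addr0 => [|s]; last by rewrite (rank0 s z) eqxx.
    by rewrite mxE eqxx mulr1 mulrC subrr.
have : forall i, exists v : 'rV_(r b.+2), leZ (mu i) al ->
    [/\ row i (g%:M - E b *m H) = v *m E b.+1,
        hommx (@wexp n) (fun _ => mu i + mu k) (@mu b.+2) v &
        forall l, v 0 l != 0 -> leZ (mu l) al].
  move=> i; case: (boolP (leZ (mu i) al)) => [ial|_]; last by exists 0.
  have [hu su] := homotopy_defect hg hH sH ial.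
  by have [v hv] := kernel_lift hu su (eH i ial); exists v.
move=> /fin_all_exists [v hv].
pose H' := \matrix_(i, l) (if leZ (mu i) al then v i 0 l else 0).
have rowH' i : leZ (mu i) al -> row i H' = v i.
  by move=> ial; apply/rowP => l; rewrite !mxE ial.
exists H'; split.
- move=> i l; rewrite mxE; case: ifP => [/hv[_ h _]|_]; last exact: homw0.
  exact: h.
- move=> i l; rewrite mxE; case: ifP => [/hv[_ _ h]|_]; last by rewrite eqxx.
  exact: h.
move=> i ial; rewrite -row_mul mulmxBl mul_scalar_mx -mulmxA raddfB /=.
have -> : row i (E b.+1 *m (H' *m E b.+1)) = row i (E b.+1 *m (g%:M - E b *m H)).
  apply/rowP => l; rewrite [LHS]mxE [RHS]mxE [LHS]mxE [RHS]mxE.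
  apply: eq_bigr => s _; have [->|/leZ_entry nz] := eqVneq (E b.+1 i s) 0.
    by rewrite !mul0r.
  have sal := leZ_trans nz ial; have [/rowP/(_ l) es _ _] := hv s sal.
  by rewrite -(rowH' s sal) -row_mul [RHS]mxE [LHS]mxE in es; rewrite es.
rewrite mulmxBr mulmxA complexE mul0mx subr0 mul_mx_scalar subrr //.
Qed.

(** Either the entry [(j, j)] of [d H] has a nonzero term, and its factor in [H]
    has nonnegative multidegree, or the cycle left over from [g e_j] has [j]-th
    coordinate [g], which minimality forbids. *)
Theorem multidegree_subadditive a (j : 'I_(r a.+1)) :
  exists (i : 'I_(r a)) (k : 'I_(r 1)), tot (mu j) <= tot (mu i) + tot (mu k).
Proof.
have [k kj] := generator_below j; have [z gnz] := row_neq0 k.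
have [H [hH sH eH]] := truncated_homotopy z a kj.
have hg : homw (@wexp n) (mu k) (E 0 k z) by have := homE k z; rewrite mu0 subr0.
have jj : leZ (mu j) (mu j) by apply/leZP.
have [/existsP[i nz]|/existsPn no_i] := boolP [exists i, E a j i * H i j != 0].
  exists i, k; rewrite -totD; apply: leZ_tot.
  apply: homw_leZ (hH i j) _.
  by apply: contraNneq nz => ->; rewrite mulr0.
have [hu su] := homotopy_defect hg hH sH jj; have uE := eH j jj.
set u := row j _ in hu su uE.
have uj : u 0 j = E 0 k z.
  rewrite !mxE eqxx mulr1n big1 ?subr0 // => i _.
  by apply/eqP; rewrite -[_ == _]negbK no_i.
have [m [u' [_ def_u hu']]] := hommx_divX hu su.
have u'j : u' 0 j != 0.
  by apply: contraNneq gnz => u'j0; rewrite -uj def_u mxE u'j0 mulr0.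
(* Hence the [j]-th coordinate of [u'] has multidegree 0. *)
have min_j : minZ (mu j) (mu j + mu k) = mu j.
  apply/ffunP => i; rewrite !ffunE; apply: min_idPl; rewrite lerDl.
  by have /leZP/(_ i) := leZ_entry gnz; rewrite mu0 ffunE.
have := hu' 0 j; rewrite min_j subrr => /homw_wexp_monomial/(_ u'j) [m0 [m0E u'jE]].
have m00 : m0 = 0%MM.
  by apply: wexp_inj; rewrite m0E; apply/ffunP => i; rewrite !ffunE mnm0E.
have /kernel_const0/matrixP/(_ 0 j) : u' *m E a = 0.
  by apply: (scaler_mx_eq0 (mpolyX_neq0 K m)); rewrite scalemxAl -def_u.
rewrite !mxE -m00 => c0.
by rewrite u'jE c0 scale0r eqxx in u'j.
Qed.

End Subadditivity.

(** * Minimal resolutions of monomial ideals *)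

Section MonomialIdeal.

Variables (K : fieldType) (n : nat) (I : {pred {mpoly K[n]}}).
Hypothesis hI : monomial_ideal I.

Lemma monomial_ideal_mulr f g : f \in I -> g * f \in I.
Proof.
have [A hA] := hI => /hA[s hs ->]; apply/hA.
exists [seq (g * c.1, c.2) | c <- s]; first by move=> _ /mapP[c /hs hc ->].
by rewrite big_map mulr_sumr; apply: eq_bigr => c _; rewrite mulrA.
Qed.

Lemma monomial_ideal_comp al f : f \in I -> compw (@wexp n) al f \in I.
Proof.
have [A hA] := hI => /hA[s hs ->]; apply/hA.
pose e (g : {mpoly K[n]}) := wexp (head 0%MM (msupp g)).
exists [seq (compw (@wexp n) (al - e c.2) c.1, c.2) | c <- s].
  by move=> _ /mapP[c /hs hc ->].
rewrite big_map compw_sum; apply: eq_big_seq => c /hs[m _ ->] /=.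
rewrite mulrC (@compwMl _ _ _ _ (@wexpD n) _ (e 'X_[m])) 1?mulrC //.
by rewrite /homw /e msuppX /= eqxx.
Qed.

End MonomialIdeal.

Section MinimalResolution.

Variables (K : fieldType) (n : nat) (I : {pred {mpoly K[n]}}).
Hypothesis hI : monomial_ideal I.
Variable F : graded_free_resolution I.
Hypothesis hF : minimal_resolution F.

Lemma irrelevant_const0 (f : {mpoly K[n]}) : irrelevant_ideal f -> f@_0 = 0.
Proof.
case=> s hs ->; rewrite raddf_sum big1_seq // => c /andP[_ /hs[i ->]].
by rewrite [LHS](rmorphM (mcoeff 0%MM)) /= mcoeffX mnm1_eq0 mulr0.
Qed.

Lemma diff_const0 b : map_mx (cst K n) (diff F b) = 0.
Proof. by apply/matrixP => i j; rewrite !mxE; apply/irrelevant_const0/hF. Qed.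

Lemma diff_hommx b : hommx (@zdeg n) (deg F b.+1) (deg F b) (diff F b).
Proof. exact: diff_homog. Qed.

(** The element [e_i - aug_i v] of [F_0] maps into [I], so it is a boundary and
    its constant part vanishes.  It follows that [F_0] has rank at most one and that its
    generator has degree 0. *)
Lemma aug_const (v : 'rV_(rank F 0)) : 1 - (v *m aug F) 0 0 \in I ->
  forall i k, (aug F i 0)@_0 * (v 0 k)@_0 = (i == k)%:R.
Proof.
move=> hv i k.
have /exact_0[u /rowP/(_ k)] : ((delta_mx 0 i - aug F i 0 *: v) *m aug F) 0 0 \in I.
  suff -> : ((delta_mx 0 i - aug F i 0 *: v) *m aug F) 0 0 =
      aug F i 0 * (1 - (v *m aug F) 0 0) by exact: monomial_ideal_mulr.
  by rewrite mulmxBl -rowE -scalemxAl !mxE mulrBr mulr1.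
move=> /(congr1 (cst K n)); have -> : cst K n ((u *m diff F 0) 0 k) = 0.
  have /rowP/(_ k) := map_mxM (cst K n) u (diff F 0).
  by rewrite diff_const0 mulmx0 !mxE.
rewrite !mxE mcoeffB [X in _ - X](rmorphM (mcoeff 0%MM)) /= => /eqP.
by rewrite subr_eq0 [k == i]eq_sym mcoeffMn mcoeff1 eqxx => /eqP <-.
Qed.

Lemma rank0_le1 (i j : 'I_(rank F 0)) : i = j.
Proof.
have [v /aug_const hv] := aug_surj F 1; apply/eqP.
have := hv i j; case: eqP => // _ /eqP; rewrite mulf_eq0.
have := hv i i; have := hv j j; rewrite !eqxx => hj hi /orP[] /eqP h0.
  by have /eqP := hi; rewrite h0 mul0r eq_sym oner_eq0.
by have /eqP := hj; rewrite h0 mulr0 eq_sym oner_eq0.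
Qed.

Lemma deg0_eq0 (i : 'I_(rank F 0)) : deg F 0 i = 0.
Proof.
have [v /aug_const/(_ i i)] := aug_surj F 1; rewrite eqxx => hv.
have nz : (aug F i 0)@_0 != 0.
  by apply: contra_eq_neq hv => ->; rewrite mul0r eq_sym oner_eq0.
by rewrite -(homwP (@zdeg n) _ _ (aug_homog i) _ nz) /zdeg mdeg0.
Qed.

(** [P] is a base change of [F_b] after which the image of [F_(b+1)] is
    a multigraded submodule, the new basis having multidegrees [mu]. *)
Definition multigraded_stage b (P : 'M[{mpoly K[n]}]_(rank F b))
    (mu : 'I_(rank F b) -> {ffun 'I_n -> int}) : Prop :=
  [/\ P \in unitmx, hommx (@zdeg n) (deg F b) (deg F b) P,
      forall j, tot (mu j) = deg F b j &
      forall al (v : 'rV_(rank F b.+1)), exists u : 'rV_(rank F b.+1),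
        compmx (@wexp n) (fun _ => al) mu (v *m (diff F b *m invmx P)) =
        u *m (diff F b *m invmx P)].

Lemma multigraded_stage0 : multigraded_stage (b := 0) 1%:M (fun _ => 0).
Proof.
split; first exact: unitmx1.
- exact: hommx1 (@zdegD n) _ _.
- by move=> j; rewrite deg0_eq0 /tot big1 // => i _; rewrite ffunE.
move=> al v; rewrite invmx1 mulmx1; apply/exact_0.
have hom_aug : hommx (@wexp n) (fun _ => 0) (fun _ => 0) (aug F).
  move=> i j; rewrite subr0 ord1.
  have := @aug_homog _ _ _ F i; rewrite deg0_eq0 => /homw0_const ->.
  by rewrite -[_%:MP]mulr1 mul_mpolyC; apply: homwZ; apply: homw1 (@wexpD n).
rewrite -(compmxM (@wexpD n) _ _ hom_aug) mxE.
by apply: monomial_ideal_comp => //; apply/exact_0; exists v.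
Qed.

(** In the new basis of [F_(b+1)] the differential is multihomogeneous, so its
    kernel, which is the image of [F_(b+2)], is multigraded. *)
Lemma multigraded_stageS b P mu : multigraded_stage (b := b) P mu ->
  exists P' mu', multigraded_stage (b := b.+1) P' mu' /\
    hommx (@wexp n) mu' mu (P' *m (diff F b *m invmx P)).
Proof.
case=> uP hP tmu closed; set D := diff F b *m invmx P.
have kerD (v : 'rV_(rank F b.+1)) : v *m D = 0 <-> v *m diff F b = 0.
  rewrite mulmxA; split=> [h|->]; last by rewrite mul0mx.
  by rewrite -[LHS](mulmxKV uP) h mul0mx.
have hD : hommx (@zdeg n) (deg F b.+1) (deg F b) D.
  exact (hommxM (@zdegD n) (@diff_hommx b) (hommx_inv (@zdegD n) uP hP)).
have indep (v : 'rV_(rank F b.+1)) : v *m D = 0 -> map_mx (cst K n) v = 0.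
  by move=> /kerD /exact_S[u ->]; rewrite map_mxM diff_const0 mulmx0.
have [P' [mu' [uP' hP' tmu' hPD]]] := multigraded_base_change tmu hD indep closed.
exists P', mu'; split=> //; split=> // al v.
have rowspace (x : 'rV_(rank F b.+1)) :
  x *m (P' *m D) = 0 <-> exists u, x = u *m (diff F b.+1 *m invmx P').
  rewrite mulmxA kerD; split=> [/exact_S[u hu]|[u ->]].
    by exists u; rewrite mulmxA -hu mulmxK.
  by apply/exact_S; exists u; rewrite mulmxA mulmxKV.
apply/rowspace; rewrite -(compmxM (@wexpD n) _ _ hPD).
rewrite (rowspace _).2 ?compmx0 //; by exists v.
Qed.

Lemma multigraded_basis :
  exists (P : forall b, 'M[{mpoly K[n]}]_(rank F b))
         (mu : forall b, 'I_(rank F b) -> {ffun 'I_n -> int}),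
    [/\ forall b, P b \in unitmx, forall b j, tot (mu b j) = deg F b j,
        forall i, mu 0 i = 0 &
        forall b, hommx (@wexp n) (mu b.+1) (mu b)
                    (P b.+1 *m (diff F b *m invmx (P b)))].
Proof.
pose stage b := {x : 'M[{mpoly K[n]}]_(rank F b) * ('I_(rank F b) -> {ffun 'I_n -> int})
                | multigraded_stage x.1 x.2}.
have next b (x : stage b) : {y : stage b.+1 |
    hommx (@wexp n) (sval y).2 (sval x).2
      ((sval y).1 *m (diff F b *m invmx (sval x).1))}.
  apply: constructive_indefinite_description.
  have [P' [mu' [good hom]]] := multigraded_stageS (svalP x).
  by exists (exist _ (P', mu') good).
pose st := nat_rect stage (exist _ (1%:M, fun _ => 0) multigraded_stage0)
             (fun b x => sval (next b x)).
exists (fun b => (sval (st b)).1), (fun b => (sval (st b)).2); split=> //.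
- by move=> b; case: (svalP (st b)).
- by move=> b j; case: (svalP (st b)).
- by move=> b; apply: (svalP (next b (st b))).
Qed.

Lemma degree_subadditive a (j : 'I_(rank F a.+1)) :
  exists (i : 'I_(rank F a)) (k : 'I_(rank F 1)),
    deg F a.+1 j <= deg F a i + deg F 1 k.
Proof.
have [P [mu [uP tmu mu0 hom]]] := multigraded_basis.
pose E b := P b.+1 *m (diff F b *m invmx (P b)).
have exactE b (v : 'rV_(rank F b.+1)) :
    v *m E b = 0 <-> exists u : 'rV_(rank F b.+2), v = u *m E b.+1.
  have -> : v *m E b = 0 <-> (v *m P b.+1) *m diff F b = 0.
    rewrite !mulmxA; split=> [h|->]; last by rewrite mul0mx.
    by rewrite -[LHS](mulmxKV (uP b)) h mul0mx.
  rewrite exact_S; split=> -[u hu].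
    exists (u *m invmx (P b.+2)).
    by rewrite /E !mulmxA mulmxKV // -hu mulmxK.
  by exists (u *m P b.+2); rewrite hu /E !mulmxA mulmxKV.
have minE b : map_mx (cst K n) (E b) = 0.
  by rewrite !map_mxM diff_const0 mul0mx mulmx0.
have [i [k hik]] := multidegree_subadditive hom exactE minE rank0_le1 mu0 j.
by exists i, k; rewrite -!tmu.
Qed.

End MinimalResolution.

Theorem corollary4 (K : fieldType) (n : nat) (I : {pred {mpoly K[n]}})
    (hI : monomial_ideal I)
    (F : graded_free_resolution I) (hF : minimal_resolution F)
    (a : nat) (ha : (1 <= a)%N) :
  (max_degree F a <= max_degree F (a - 1)%N + max_degree F 1%N)%E.
Proof.
case: a ha => // a _; rewrite subn1 /=.
apply: bigmax_le => [|j _]; first exact: leNye.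
have [i [k hik]] := degree_subadditive hI hF j.
apply: (@le_trans _ _ ((deg F a i)%:E + (deg F 1 k)%:E)%E).
  by rewrite -EFinD lee_fin.
by apply: leeD; apply: le_bigmax.
Qed.
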